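(* There exists an absolute constant $C>0$ such that for every $n\ge 1$ and every real $p\ge 1$ the following holds. Given a probability measure $\mu$ on $\mathbb{R}^n$ with compact support $K$, $$\min_{\xi\in S^{n-1}}\Big(\int |(x,\xi)|^p\,d\mu(x)\Big)^{1/p}\;\le\; C\sqrt{p}\;V(K,L_p^n).$$ In particular, if $f$ is a non-negative continuous function on a compact set $K\subseteq\mathbb{R}^n$ of positive volume, then $$\min_{\xi\in S^{n-1}} \int_K |(x,\xi)|^p f(x)\,dx \;\le\; (Cp)^{p/2}\, d_{\rm ovr}^{\,p}(K,L_p^n)\,|K|^{p/n}\int_K f(x)\,dx,$$ where $C$ is again an absolute constant.
   Context: $(x,y)$ is the standard scalar product in $\mathbb{R}^n$, $S^{n-1}$ the Euclidean unit sphere centered at the origin, and $|K|$ denotes volume. A convex body is a compact convex set with non-empty interior; it is centrally-symmetric if $D=-D$. For a centrally-symmetric convex body $D$, $\|x\|_D=\inf\{a\ge 0: x\in aD\}$. The class $L_p^n$ of unit balls of $n$-dimensional subspaces of $L_p$ is, equivalently, the class of all centrally-symmetric convex bodies $D\subseteq\mathbb{R}^n$ for which there is a finite Borel measure $\nu_D$ on $S^{n-1}$ with $$\|x\|_D^p=\int_{S^{n-1}}|(x,\theta)|^p\,d\nu_D(\theta)\quad\text{for all }x\in\mathbb{R}^n.$$ For a bounded set $K\subseteq\mathbb{R}^n$, $$V(K,L_p^n)=\inf\{|D|^{1/n}: K\subseteq D,\ D\in L_p^n\},$$ and for measurable $K$ of positive volume, $$d_{\rm ovr}(K,L_p^n)=\inf\Big\{\Big(\frac{|D|}{|K|}\Big)^{1/n}: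 K\subseteq D,\ D\in L_p^n\Big\}.$$ *)

(* Defs.v *)
From HB Require Import structures.
From mathcomp Require Import all_boot all_order all_algebra.
From mathcomp Require Import all_classical all_reals all_analysis.
From mathcomp Require Import measurable_realfun.

Set Implicit Arguments.
Unset Strict Implicit.
Unset Printing Implicit Defensive.

Import Order.TTheory GRing.Theory Num.Theory.
Import numFieldNormedType.Exports.

Local Open Scope classical_set_scope.
Local Open Scope ring_scope.

Definition borel_mx_display : measure_display.
Proof. exact: default_measure_display. Qed.

Section borel_mx.
Context {R : realType} {m n : nat}.

Definition borel_mx : set (set 'M[R]_(m, n)) := <<s open >>.

Let borel_mx0 : borel_mx set0. Proof. exact: sigma_algebra0. Qed.

Let borel_mxC A : borel_mx A -> borel_mx (~` A).
Proof. exact: sigma_algebraC. Qed.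

Let borel_mxU (F : _^nat) : (forall i, borel_mx (F i)) ->
  borel_mx (\bigcup_i F i).
Proof. exact: sigma_algebra_bigcup. Qed.

(* The topology of 'M[R]_(m, n) is the entrywise one, so for row vectors these
   are the usual Borel sets of R^n. *)
HB.instance Definition _ := @isMeasurable.Build borel_mx_display
  'M[R]_(m, n) borel_mx borel_mx0 borel_mxC borel_mxU.

End borel_mx.

Section borel_rV.
Context {R : realType}.

Lemma measurable_coord n (i : 'I_n) :
  measurable_fun [set: 'rV[R]_n] (fun x : 'rV[R]_n => x 0 i).
Proof.
apply: (measurability _ (RGenOInfty.measurableE R)) => _ [_ [a ->] <-].
rewrite setTI; apply: sub_sigma_algebra.
apply: open_comp; last exact: interval_open.
by move=> x _; exact: coord_continuous.
Qed.

Lemma open_rV_bigcup n (U : set 'rV[R]_n) : open U ->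
  U = \bigcup_(f : {ffun 'I_n -> rat * rat})
    [set x | (forall i, ratr (f i).1 < x 0 i < ratr (f i).2) /\
      forall y : 'rV[R]_n,
        (forall i, ratr (f i).1 < y 0 i < ratr (f i).2) -> U y].
Proof.
move=> oU; apply/seteqP; split => [x Ux|x [f _ [xf]]]; last exact.
have /nbhs_ballP[/= e e0 eU] : nbhs x U by exact: open_nbhs_nbhs.
have /choice[q qP] i : exists q : rat * rat, [/\ x 0 i - e < ratr q.1,
    ratr q.1 < x 0 i, x 0 i < ratr q.2 & ratr q.2 < x 0 i + e].
  have [|a /itvP a_] := @rat_in_itvoo R (x 0 i - e) (x 0 i).
    by rewrite ltrBlDr ltrDl.
  have [|b /itvP b_] := @rat_in_itvoo R (x 0 i) (x 0 i + e).
    by rewrite ltrDl.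
  by exists (a, b); rewrite /= !a_ !b_.
exists [ffun i => q i] => //=; split => [i|y yq].
  by rewrite ffunE; case: (qP i) => _ -> ->.
apply: eU; split=> // i j; rewrite ord1 /ball/=.
have := yq j; rewrite ffunE; case: (qP j) => x1 x2 x3 x4 /andP[y1 y2].
rewrite ltr_distlC; apply/andP; split; first exact: lt_trans y1.
exact: lt_trans x4.
Qed.

Lemma measurable_fun_rV d (T : measurableType d) n (f : T -> 'rV[R]_n) :
  (forall i, measurable_fun [set: T] (fun t => f t 0 i)) ->
  measurable_fun [set: T] f.
Proof.
move=> mf; apply: (@measurability _ _ T 'rV[R]_n setT f open) => //.
move=> _ [U oU <-]; rewrite setTI (open_rV_bigcup oU) preimage_bigcup.
apply: countable_bigcupT_measurable; first exact: countableP.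
move=> q.
have [qU|qU] := pselect (forall y : 'rV[R]_n,
    (forall i, ratr (q i).1 < y 0 i < ratr (q i).2) -> U y); last first.
  by rewrite (_ : _ @^-1` _ = set0)// -subset0 => t [].
rewrite (_ : _ @^-1` _ = \bigcap_(i in [set: 'I_n])
    ((fun t => f t 0 i) @^-1` `]ratr (q i).1, ratr (q i).2[%classic)).
  apply: fin_bigcap_measurable => // i _.
  by rewrite -[X in measurable X]setTI; apply: mf => //; exact: measurable_itv.
apply/seteqP; split => [t [tq _] i _|t tq] /=; first by rewrite in_itv/= tq.
by split=> // i; have := tq i Logic.I; rewrite /= in_itv.
Qed.

End borel_rV.

Section lebesgue_rV.
Context {R : realType}.

Definition cons_rV n (tx : measurableTypeR R * 'rV[R]_n) : 'rV[R]_n.+1 :=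
  row_mx (const_mx tx.1 : 'rV_1) tx.2.

Lemma cons_rVE n (tx : measurableTypeR R * 'rV[R]_n) (i : 'I_n.+1) :
  cons_rV tx 0 i = if unlift 0 i is Some j then tx.2 0 j else tx.1.
Proof.
rewrite /cons_rV; case: unliftP => [j|] ->.
  have -> : lift 0 j = rshift 1 j by exact: val_inj.
  exact: row_mxEr.
transitivity (row_mx (const_mx tx.1 : 'rV_1) tx.2 0 (lshift n (0 : 'I_1))).
  by congr (row_mx _ _ _ _); exact: val_inj.
by rewrite row_mxEl mxE.
Qed.

Lemma measurable_cons_rV n : measurable_fun [set: measurableTypeR R * 'rV[R]_n] (@cons_rV n).
Proof.
apply: measurable_fun_rV => i; under eq_fun do rewrite cons_rVE.
case: (unlift 0 i) => [j|]; last exact: measurable_fst.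
exact: (measurableT_comp (measurable_coord j)).
Qed.

Definition uncons_rV n (x : 'rV[R]_n.+1) : measurableTypeR R * 'rV[R]_n :=
  (x 0 0, \row_j x 0 (lift 0 j)).

Lemma cons_rVK n : cancel (@cons_rV n) (@uncons_rV n).
Proof.
move=> [t x]; rewrite /uncons_rV cons_rVE unlift_none; congr pair.
by apply/rowP => j; rewrite mxE cons_rVE liftK.
Qed.

Lemma measurable_uncons_rV n :
  measurable_fun [set: 'rV[R]_n.+1] (@uncons_rV n).
Proof.
apply/measurable_fun_pairP; split; first exact: measurable_coord.
apply: measurable_fun_rV => i /=; under eq_fun do rewrite mxE.
exact: measurable_coord.
Qed.

Section step.
Variables (n : nat) (mu : {sigma_finite_measure set 'rV[R]_n -> \bar R}).

Definition lebesgue_cons : set 'rV[R]_n.+1 -> \bar R :=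
  pushforward (lebesgue_measure \x mu)%E (@cons_rV n).

HB.instance Definition _ := Measure.copy lebesgue_cons
  (measure_function_pushforward__canonical__measure_function_Measure
    (lebesgue_measure \x mu)%E (@measurable_cons_rV n)).

Let lebesgue_cons_sigma_finite : sigma_finite setT lebesgue_cons.
Proof.
have /sigma_finiteP[F [TF ndF Foo]] := sigma_finiteT (@lebesgue_measure R).
have /sigma_finiteP[G [TG ndG Goo]] := sigma_finiteT mu.
exists (fun k => @uncons_rV n @^-1` (F k `*` G k)).
  rewrite -preimage_bigcup -[LHS](preimage_setT (@uncons_rV n)).
  congr (_ @^-1` _); apply/seteqP; split => [[t x] _|//].
  have [i _ Fi] : (\bigcup_i F i) t by rewrite -TF.
  have [j _ Gj] : (\bigcup_j G j) x by rewrite -TG.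
  exists (maxn i j) => //; split => /=.
    by move: Fi; exact/subsetPset/ndF/leq_maxl.
  by move: Gj; exact/subsetPset/ndG/leq_maxr.
move=> k; have [mF Fk] := Foo k; have [mG Gk] := Goo k; split.
  rewrite -[X in measurable X]setTI; apply: measurable_uncons_rV => //.
  exact: measurableX.
rewrite /lebesgue_cons /pushforward -comp_preimage.
rewrite (_ : _ \o _ = idfun); last by apply/funext; exact: cons_rVK.
by rewrite product_measure1E// lte_mul_pinfty// ge0_fin_numE.
Qed.

HB.instance Definition _ := Measure_isSigmaFinite.Build _ _ _
  lebesgue_cons lebesgue_cons_sigma_finite.

End step.

(* n-dimensional Lebesgue measure, as the n-fold product of the one-dimensional
   one; lebesgue_rV_box below characterizes it. *)
Fixpoint lebesgue_rV n : {sigma_finite_measure set 'rV[R]_n -> \bar R} :=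
  if n is k.+1 then lebesgue_cons (lebesgue_rV k) else \d_(0 : 'rV[R]_0).

Lemma lebesgue_rV_box n (A : 'I_n -> set R) : (forall i, measurable (A i)) ->
  lebesgue_rV n [set x | forall i, A i (x 0 i)] =
  (\prod_(i < n) lebesgue_measure (A i))%E.
Proof.
elim: n A => [|n IH] A mA.
  by rewrite big_ord0 /= diracE mem_set// => -[].
have mB : measurable [set x : 'rV[R]_n | forall i, A (lift 0 i) (x 0 i)].
  rewrite (_ : mkset _ = \bigcap_(i in [set: 'I_n])
      ((fun x : 'rV[R]_n => x 0 i) @^-1` A (lift 0 i))).
    apply: fin_bigcap_measurable => // i _.
    by rewrite -[X in measurable X]setTI; exact: measurable_coord.
  by apply/seteqP; split => x Ax i => [_|]; exact: Ax.
rewrite big_ord_recl -IH//= -product_measure1E//; last exact: mA.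
rewrite /lebesgue_cons /pushforward; congr product_measure1.
apply/seteqP; split => [[t x] Atx|[t x] [At Ax] i] /=.
  split=> [|i].
    by have := Atx 0; rewrite cons_rVE unlift_none.
  by have := Atx (lift 0 i); rewrite cons_rVE liftK.
by rewrite cons_rVE; case: unliftP => [j ->|->//]; exact: Ax.
Qed.

End lebesgue_rV.

Section convex_bodies.
Context {R : realType} {n : nat}.
Implicit Types (x y xi : 'rV[R]_n) (D K : set 'rV[R]_n) (p : R).

Definition dotp x y : R := \sum_i x 0 i * y 0 i.

Definition unit_sphere : set 'rV[R]_n := [set x | Num.sqrt (dotp x x) = 1].

Definition convex_body D := [/\ compact D, convex_set D & D° !=set0].

Definition centrally_symmetric D := [set - x | x in D] = D.

(* The Minkowski functional of D. *)
Definition gauge D x : R := inf [set a | 0 <= a /\ [set a *: y | y in D] x].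

(* D is the unit ball of an n-dimensional subspace of L_p. A finite Borel
   measure on the sphere is given as the restriction to the sphere of a finite
   Borel measure nu on R^n. *)
Definition Lp_ball p D := [/\ convex_body D, centrally_symmetric D &
  exists nu : {finite_measure set 'rV[R]_n -> \bar R}, forall x,
    ((gauge D x `^ p)%:E =
     \int[nu]_(theta in unit_sphere) (`|dotp x theta| `^ p)%:E)%E].

(* The infima are taken in the extended reals: an infimum over an empty family
   would be +oo. *)
Definition volume_radius_Lp p K : \bar R :=
  ereal_inf [set (lebesgue_rV n D `^ n%:R^-1)%E |
             D in [set D | K `<=` D /\ Lp_ball p D]].

Definition d_ovr_Lp p K : \bar R :=
  ereal_inf [set ((lebesgue_rV n D / lebesgue_rV n K) `^ n%:R^-1)%E |
             D in [set D | K `<=` D /\ Lp_ball p D]].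

Definition measure_support (mu : {measure set 'rV[R]_n -> \bar R}) :
    set 'rV[R]_n :=
  [set x | forall U, open_nbhs x U -> (0 < mu U)%E].

End convex_bodies.

(* Main.v *)
Require Import Defs.
From HB Require Import structures.
From mathcomp Require Import all_boot all_order all_algebra.
From mathcomp Require Import all_classical all_reals all_analysis.
From mathcomp Require Import measurable_realfun ring lra.

(** Let [K] be contained in an L_p ball [D] with representing measure [nu], and
    let [m] be the minimum over the sphere of the [p]-th moments of a
    probability [mu] on [K]. Integrating against [nu] and exchanging the
    integrals, [m * nu S <= \int ||x||_D^p dmu <= 1], so that a lower bound for
    the mass of [nu] is needed. The Gaussian-type tails of the uniform measure
    on a cube give one without polar coordinates: if [Q] is the cube of volume
    [2|D|] centered at the origin, then [||x||_D >= 1] on [Q \ D], of volume at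
    least [|D|], while the [p]-th moment of [Q] in any unit direction is at most
    [(C sqrt p |D|^(1/n))^p |Q|]; integrating [||x||_D^p] over [Q] yields
    [1 <= 2 nu(S) (C sqrt p |D|^(1/n))^p]. *)

Set Implicit Arguments.
Unset Strict Implicit.
Unset Printing Implicit Defensive.

Import Order.TTheory GRing.Theory Num.Theory.
Import numFieldNormedType.Exports.

Local Open Scope classical_set_scope.
Local Open Scope ring_scope.

Lemma expR_le_id_sqr (R : realType) (u : R) : expR u <= u + expR (2 * u ^+ 2).
Proof.
have sq0 : 0 <= u ^+ 2 by exact: sqr_ge0.
have e1 := expR_ge1Dx (2 * u ^+ 2).
have [u2|u2] := lerP 2^-1 u.
  have : expR u <= expR (2 * u ^+ 2) by rewrite ler_expR; nra.
  by move=> ?; lra.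
have [u3|u3] := lerP u (- 2^-1).
  have : expR u <= expR 0 by rewrite ler_expR; lra.
  by rewrite expR0 => ?; nra.
have u4 : 0 < 1 - u by lra.
have : expR u <= (1 - u)^-1.
  by rewrite -[leLHS]invrK -expRN lef_pV2 ?posrE ?expR_gt0// expR_ge1Dx.
move=> /le_trans; apply.
rewrite -[leLHS]mul1r ler_pdivrMr//.
have : 0 <= u ^+ 2 * (1 - 2 * u) by rewrite mulr_ge0//; lra.
by nra.
Qed.

Lemma integral_affine_sym (R : realType) (a b r : R) : 0 < r ->
  (\int[lebesgue_measure]_(t in `[(- r)%R, r]) (a * t + b)%:E)%E = (2 * r * b)%:E.
Proof.
move=> r0.
pose F : R -> R := fun t => a * (t ^+ 2 / 2) + b * t.
have dF (t : R) : is_derive t (1 : R) F (a * t + b).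
  apply: is_derive_eq => /=.
  by rewrite /GRing.scale/= ; field.
have cF : continuous F.
  by move=> x; apply/differentiable_continuous/derivable1_diffP; case: (dF x).
rewrite (@continuous_FTC2 _ _ F).
- by rewrite -EFinB /F; congr EFin; field.
- by lra.
- apply: continuous_subspaceT => x.
  apply: cvgD; last exact: cvg_cst.
  by apply: cvgM; [exact: cvg_cst|exact: cvg_id].
- split.
  + by move=> x _; case: (dF x).
  + by apply: cvg_at_right_filter; exact: cF.
  + by apply: cvg_at_left_filter; exact: cF.
- by move=> x _; rewrite derive1E; apply: derive_val.
Qed.

Lemma integral_expR_sym (R : realType) (a r : R) : 0 < r ->
  (\int[lebesgue_measure]_(t in `[(- r)%R, r]) (expR (a * t))%:E <=
   (2 * r * expR (2 * (a * r) ^+ 2))%:E)%E.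
Proof.
move=> r0; rewrite -(integral_affine_sym a _ r0).
apply: ge0_le_integral => //=.
- apply/measurable_EFinP; apply: measurable_funTS.
  apply: measurableT_comp => //; exact: measurable_funM.
- apply/measurable_EFinP; apply: measurable_funTS.
  apply: measurable_funD => //; exact: measurable_funM.
- move=> t; rewrite in_itv/= => /andP[t1 t2]; rewrite lee_fin.
  apply: le_trans (expR_le_id_sqr _) _; rewrite lerD2l ler_expR.
  rewrite ler_pM2l// !exprMn ler_wpM2l ?sqr_ge0//.
  by nra.
Qed.

Lemma powR_le_expR (R : realType) (p c y : R) : 0 < p -> 0 < c -> 0 <= y ->
  y `^ p <= (c * p) `^ p * expR (y / c).
Proof.
move=> p0 c0 y0.
have cp0 : 0 < c * p by rewrite mulr_gt0.
have -> : y `^ p = (c * p) `^ p * (y / (c * p)) `^ p.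
  rewrite -powRM; [|exact: ltW|by apply: divr_ge0 => //; exact: ltW].
  by congr (_ `^ _); field; rewrite !gt_eqF.
rewrite ler_wpM2l ?powR_ge0//.
have -> : y / c = y / (c * p) * p by field; rewrite !gt_eqF.
rewrite expRM ge0_ler_powR ?nnegrE ?expR_ge0 ?divr_ge0 ?(ltW cp0) ?(ltW p0)//.
by have := expR_ge1Dx (y / (c * p)); lra.
Qed.

Section product_integral.
Context {R : realType}.

Lemma measurable_rV_prod n (g : 'I_n -> R -> R) :
  (forall i, measurable_fun [set: R] (g i)) ->
  measurable_fun [set: 'rV[R]_n] (fun x : 'rV[R]_n => \prod_i g i (x 0 i)).
Proof.
move=> mg; apply: measurable_prod => i _.
exact: (measurableT_comp (mg i) (measurable_coord i)).
Qed.

Lemma integral_rV_prod n (g : 'I_n -> R -> R) :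
  (forall i, measurable_fun [set: R] (g i)) -> (forall i t, 0 <= g i t) ->
  (\int[lebesgue_rV n]_x (\prod_i g i (x 0 i))%:E =
   \prod_i \int[lebesgue_measure]_t (g i t)%:E)%E.
Proof.
elim: n g => [|n IH] g mg g0.
  rewrite big_ord0 (_ : (fun _ => _) = cst 1%E); last first.
    by apply/funext => x; rewrite big_ord0.
  by rewrite integral_cst//= diracT mule1.
pose h (x : 'rV[R]_n) := \prod_i g (lift 0 i) (x 0 i).
have mh : measurable_fun setT h by exact: (@measurable_rV_prod n (fun i => g (lift 0 i))).
have h0 x : 0 <= h x by exact: prodr_ge0.
have E (z : measurableTypeR R * 'rV[R]_n) :
    \prod_i g i (cons_rV z 0 i) = g 0 z.1 * h z.2.
  rewrite big_ord_recl cons_rVE unlift_none; congr (_ * _).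
  by apply: eq_bigr => i _; rewrite cons_rVE liftK.
rewrite big_ord_recl -(IH (fun i => g (lift 0 i)))//.
rewrite (@ge0_integral_pushforward _ _ _ _ _ _ (@measurable_cons_rV _ n)
  (lebesgue_measure \x lebesgue_rV n)%E setT
  (fun x : 'rV[R]_n.+1 => (\prod_i g i (x 0 i))%:E))//=; last 2 first.
- by apply/measurable_EFinP; exact: measurable_rV_prod.
- by move=> x _; rewrite lee_fin prodr_ge0.
rewrite preimage_setT.
under eq_integral do rewrite E.
rewrite fubini_tonelli1/=; last 2 first.
- apply/measurable_EFinP; apply: measurable_funM.
    exact: (measurableT_comp (mg 0)).
  exact: (measurableT_comp mh).
- by move=> z; rewrite lee_fin mulr_ge0.
rewrite /fubini_F/=.
under eq_integral => t _.
  under eq_integral do rewrite EFinM.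
  rewrite ge0_integralZl_EFin//; last 2 first.
  - by move=> x _; rewrite lee_fin.
  - exact/measurable_EFinP.
  over.
rewrite ge0_integralZr//.
- by apply/measurable_EFinP; exact: mg.
- by move=> x _; rewrite lee_fin.
- by apply: integral_ge0 => x _; rewrite lee_fin.
Qed.

End product_integral.

Section dot_product.
Context {R : realType} {n : nat}.
Implicit Types x y v : 'rV[R]_n.

Lemma dotpC x y : dotp x y = dotp y x.
Proof. by apply: eq_bigr => i _; rewrite mulrC. Qed.

Lemma dotpZr a x y : dotp x (a *: y) = a * dotp x y.
Proof. by rewrite mulr_sumr; apply: eq_bigr => i _; rewrite mxE mulrCA. Qed.

Lemma dotpBr x y z : dotp x (y - z) = dotp x y - dotp x z.
Proof.
by rewrite -sumrB; apply: eq_bigr => i _; rewrite !mxE mulrBr.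
Qed.

Lemma unit_sphere_dotp v : unit_sphere v <-> dotp v v = 1.
Proof.
split=> [v1|]; last by rewrite /unit_sphere/= => ->; exact: sqrtr1.
have v0 : 0 <= dotp v v by apply: sumr_ge0 => i _; rewrite -expr2 sqr_ge0.
by rewrite -[LHS]sqr_sqrtr// v1 expr1n.
Qed.

Lemma measurable_dotp d (T : measurableType d) (f g : T -> 'rV[R]_n) :
  measurable_fun [set: T] f -> measurable_fun [set: T] g ->
  measurable_fun [set: T] (fun t => dotp (f t) (g t)).
Proof.
move=> mf mg; apply: measurable_sum => i; apply: measurable_funM.
  exact: (measurableT_comp (measurable_coord i) mf).
exact: (measurableT_comp (measurable_coord i) mg).
Qed.

Lemma measurable_norm_dotp_powR p d (T : measurableType d)
    (f g : T -> 'rV[R]_n) :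
  measurable_fun [set: T] f -> measurable_fun [set: T] g ->
  measurable_fun [set: T] (fun t => `|dotp (f t) (g t)| `^ p).
Proof.
move=> mf mg; apply: (measurableT_comp (measurable_powR p)).
by apply: measurableT_comp => //; exact: measurable_dotp.
Qed.

Lemma measurable_unit_sphere : measurable (@unit_sphere R n).
Proof.
rewrite (_ : unit_sphere = (fun x : 'rV[R]_n => dotp x x) @^-1` [set 1]).
  rewrite -[X in measurable X]setTI.
  have : measurable_fun setT (fun x : 'rV[R]_n => dotp x x).
    exact: measurable_dotp.
  by apply => //; exact: measurable_set1.
by apply/seteqP; split => v /unit_sphere_dotp.
Qed.

Lemma closed_measurable_rV (K : set 'rV[R]_n) : closed K -> measurable K.
Proof.
move=> cK; rewrite -[K]setCK; apply: measurableC.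
by apply: sub_sigma_algebra; rewrite openC.
Qed.

Lemma compact_closed_rV (K : set 'rV[R]_n) : compact K -> closed K.
Proof. by apply: compact_closed; exact: norm_hausdorff. Qed.

Lemma compact_measurable_rV (K : set 'rV[R]_n) : compact K -> measurable K.
Proof. by move=> /compact_closed_rV; exact: closed_measurable_rV. Qed.

End dot_product.

Section cube.
Context {R : realType}.

Definition cube n (r : R) : set 'rV[R]_n :=
  [set x | forall i, `[- r, r]%classic (x 0 i)].

Arguments cube n r : clear implicits.

Lemma indic_cube n r (x : 'rV[R]_n) :
  \1_(cube n r) x = \prod_i \1_(`[- r, r]%classic : set R) (x 0 i) :> R.
Proof.
rewrite indicE; have [/set_mem xr|xr] := boolP (x \in cube n r).
  by rewrite big1// => i _; rewrite indicE mem_set.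
have [i xi] : exists i, ~ `[- r, r]%classic (x 0 i).
  by apply/existsNP => xi; move/negP: xr; apply; exact/mem_set.
by rewrite (bigD1 i)//= indicE memNset// mul0r.
Qed.

Lemma measurable_cube n r : measurable (cube n r).
Proof.
rewrite (_ : cube n r = (fun x => \1_(cube n r) x) @^-1` [set (1 : R)]).
  rewrite -[X in measurable X]setTI.
  have : measurable_fun [set: 'rV[R]_n]
      (fun x : 'rV[R]_n => \1_(cube n r) x : R).
    under eq_fun do rewrite indic_cube.
    apply: (@measurable_rV_prod _ n (fun _ => \1_(`[- r, r]%classic : set R))).
    by move=> i; exact: measurable_indic.
  by apply => //; exact: measurable_set1.
apply/seteqP; split => x /=; first by move=> xr; rewrite indicE mem_set.
rewrite indicE; have [/set_mem//|_ /eqP] := boolP (x \in cube n r).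
by rewrite eq_sym oner_eq0.
Qed.

Lemma lebesgue_cube n r : 0 < r -> lebesgue_rV n (cube n r) = ((2 * r) ^+ n)%:E.
Proof.
move=> r0.
rewrite (@lebesgue_rV_box _ n (fun=> `[- r, r]%classic))// -[n in RHS]card_ord -prodr_const.
rewrite (big_morph (@EFin R) (@EFinM R) erefl).
apply: eq_bigr => i _; rewrite lebesgue_measure_itv/= lte_fin ifT; last by lra.
by rewrite -EFinB; congr EFin; ring.
Qed.

Lemma integral_cube_expR n r (v : 'rV[R]_n) : 0 < r ->
  (\int[lebesgue_rV n]_x (\1_(cube n r) x * expR (dotp x v))%:E <=
   ((2 * r) ^+ n * expR (2 * r ^+ 2 * dotp v v))%:E)%E.
Proof.
move=> r0.
pose g (i : 'I_n) (t : R) : R :=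
  \1_(`[- r, r]%classic : set R) t * expR (v 0 i * t).
have -> : (fun x : 'rV[R]_n => (\1_(cube n r) x * expR (dotp x v))%:E) =
    (fun x => (\prod_i g i (x 0 i))%:E).
  apply/funext => x; rewrite indic_cube /dotp expR_sum -big_split/=.
  by congr EFin; apply: eq_bigr => i _; rewrite /g [v 0 i * _]mulrC.
rewrite integral_rV_prod; last 2 first.
- move=> i; apply: measurable_funM; first exact: measurable_indic.
  by apply: measurableT_comp => //; exact: measurable_funM.
- by move=> i t; rewrite mulr_ge0 ?expR_ge0.
rewrite -[n in _ ^+ n]card_ord -prodr_const mulr_sumr expR_sum -big_split/=.
rewrite (big_morph (@EFin R) (@EFinM R) erefl).
suff /andP[] : (0 <= \prod_(i < n) \int[lebesgue_measure]_t (g i t)%:E <=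
    \prod_(i < n) (2 * r * expR (2 * r ^+ 2 * (v 0 i * v 0 i)))%:E)%E by [].
apply: (big_ind2 (fun x y : \bar R => 0 <= x <= y)%E).
- by rewrite lee01 lexx.
- move=> x1 y1 x2 y2 /andP[x1p xy1] /andP[x2p xy2].
  by rewrite mule_ge0//= lee_pmul.
move=> i _; apply/andP; split.
  by apply: integral_ge0 => t _; rewrite lee_fin mulr_ge0 ?expR_ge0.
have -> : 2 * r ^+ 2 * (v 0 i * v 0 i) = 2 * (v 0 i * r) ^+ 2 by ring.
apply: le_trans (integral_expR_sym _ r0).
rewrite [leRHS]integral_mkcond; rewrite le_eqVlt; apply/orP; left.
apply/eqP; apply: eq_integral => t _.
rewrite patchE /g indicE; case: ifPn => _; first by rewrite mul1r.
by rewrite mul0r.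
Qed.

Lemma integral_cube_moment n (p r : R) (v : 'rV[R]_n) :
  0 < p -> 0 < r -> dotp v v = 1 ->
  (\int[lebesgue_rV n]_x (\1_(cube n r) x * `|dotp x v| `^ p)%:E <=
   ((2 * r) ^+ n * (2 * (r * Num.sqrt p) `^ p * expR (2 * p)))%:E)%E.
Proof.
move=> p0 r0 v1.
have q0 : 0 < Num.sqrt p by rewrite sqrtr_gt0.
have qq : Num.sqrt p ^+ 2 = p by rewrite sqr_sqrtr// ltW.
set q := Num.sqrt p in q0 qq *.
pose c := r / q.
have c0 : 0 < c by rewrite divr_gt0.
have E : c * p = r * q by rewrite /c -qq; field; rewrite gt_eqF.
pose F (w : 'rV[R]_n) x := (\1_(cube n r) x * expR (dotp x w))%:E.
have mF w : measurable_fun setT (F w).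
  apply/measurable_EFinP; apply: measurable_funM.
    by apply: measurable_indic; exact: measurable_cube.
  apply: measurableT_comp => //.
  by apply: measurable_dotp => //; exact: measurable_cst.
have F0 w x : (0 <= F w x)%E by rewrite lee_fin mulr_ge0 ?expR_ge0.
have bF e : e ^+ 2 = c^-1 ^+ 2 ->
    (\int[lebesgue_rV n]_x F (e *: v) x <=
     ((2 * r) ^+ n * expR (2 * p))%:E)%E.
  move=> e2; apply: le_trans (integral_cube_expR _ r0) _.
  rewrite lee_fin dotpZr dotpC dotpZr v1 mulr1.
  have -> : 2 * r ^+ 2 * (e * e) = 2 * p; last exact: lexx.
  by rewrite -[e * e]expr2 e2 /c -qq; field; rewrite !gt_eqF.
apply: (@le_trans _ _ (\int[lebesgue_rV n]_x
    (((r * q) `^ p)%:E * (F (c^-1 *: v) x + F ((- c^-1) *: v) x)))%E).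
  apply: ge0_le_integral => //=.
  - apply/measurable_EFinP; apply: measurable_funM.
      by apply: measurable_indic; exact: measurable_cube.
    by apply: measurable_norm_dotp_powR => //; exact: measurable_cst.
  - by apply: emeasurable_funM => //; exact: emeasurable_funD.
  - move=> x _; rewrite /F -EFinD -EFinM lee_fin -mulrDr mulrCA.
    rewrite ler_wpM2l//.
    have := powR_le_expR p0 c0 (normr_ge0 (dotp x v)).
    rewrite E => /le_trans; apply.
    rewrite ler_wpM2l ?powR_ge0// !dotpZr.
    have [_|_] := ler0P (dotp x v).
      by rewrite [_ / c]mulrC mulrN -mulNr lerDr expR_ge0.
    by rewrite [_ / c]mulrC lerDl expR_ge0.
rewrite ge0_integralZl_EFin ?powR_ge0//; last 2 first.
- by move=> x _; rewrite adde_ge0.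
- exact: emeasurable_funD.
rewrite ge0_integralD//.
have -> : ((2 * r) ^+ n * (2 * (r * q) `^ p * expR (2 * p))) =
  (r * q) `^ p * ((2 * r) ^+ n * expR (2 * p) + (2 * r) ^+ n * expR (2 * p)).
  by ring.
rewrite EFinM lee_wpmul2l ?lee_fin ?powR_ge0// EFinD leeD//; apply: bF => //.
by rewrite sqrrN.
Qed.

End cube.

Arguments cube {R} n r.

Section convex_set_rV.
Context {R : realType} {n : nat}.
Implicit Types (x y : 'rV[R]_n) (D K : set 'rV[R]_n).

Lemma ler_norm_coord x i : `|x 0 i| <= `|x|.
Proof.
rewrite [leRHS]/Num.norm/= mx_normrE.
exact: (le_bigmax _ (fun ij => `|x ij.1 ij.2|) (0, i)).
Qed.

Lemma compact_sub_cube K : compact K -> exists2 r, 0 < r & K `<=` cube n r.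
Proof.
move=> /compact_bounded[M [_ KM]].
exists (`|M| + 1) => [|x Kx i]; first by rewrite ltr_wpDl.
rewrite /= in_itv/= -ler_norml; apply: le_trans (ler_norm_coord x i) _.
by apply: KM => //; rewrite (le_lt_trans (ler_norm M))// ltrDl.
Qed.

Lemma compact_volume_fin K : compact K -> (lebesgue_rV n K < +oo)%E.
Proof.
move=> cK; have [r r0 Kr] := compact_sub_cube cK.
apply: (@le_lt_trans _ _ (lebesgue_rV n (cube n r))).
  apply: le_measure => //; rewrite inE; last exact: measurable_cube.
  exact: compact_measurable_rV.
by rewrite lebesgue_cube// ltry.
Qed.

Lemma interior_volume_gt0 K : measurable K -> K° !=set0 ->
  (0 < lebesgue_rV n K)%E.
Proof.
move=> mK [c /nbhs_ballP[e /= e0 eK]].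
pose A (i : 'I_n) : set R := `]c 0 i - e, c 0 i + e[%classic.
have mA : measurable [set x : 'rV[R]_n | forall i, A i (x 0 i)].
  rewrite (_ : mkset _ =
    \bigcap_(i in [set: 'I_n]) ((fun x : 'rV[R]_n => x 0 i) @^-1` A i)).
    apply: fin_bigcap_measurable => // i _.
    by rewrite -[X in measurable X]setTI; apply: measurable_coord => //; exact: measurable_itv.
  by apply/seteqP; split => [x Ax i _|x Ax i]; exact: Ax.
apply: (@lt_le_trans _ _ (lebesgue_rV n [set x | forall i, A i (x 0 i)])).
  rewrite lebesgue_rV_box; last by move=> i; exact: measurable_itv.
  apply: (big_ind (fun x : \bar R => 0 < x)%E) => //.
    by move=> x y x0 y0; exact: mule_gt0.
  move=> i _; rewrite lebesgue_measure_itv/= lte_fin ifT; last by lra.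
  by rewrite -EFinB lte_fin; lra.
apply: le_measure; rewrite ?inE//.
move=> x Ax; apply: eK; split => // i j; rewrite ord1 /ball/=.
by have := Ax j; rewrite /A/= in_itv/= ltr_distlC.
Qed.

Lemma convex_setE D x y (t : R) : convex_set D -> D x -> D y ->
  0 <= t -> t <= 1 -> D (t *: x + (1 - t) *: y).
Proof.
by move=> cD /mem_set Dx /mem_set Dy t0 t1; exact/set_mem/(cD _ _ (Itv01 t0 t1)).
Qed.

Lemma gauge_le1 D x : D x -> gauge D x <= 1.
Proof.
move=> Dx; apply: ge_inf; first by exists 0 => a [].
by split; [exact: ler01|exists x => //; rewrite scale1r].
Qed.

Lemma gauge_ge0 D x : 0 <= gauge D x.
Proof.
rewrite /gauge; have [->|/set0P ne] := eqVneq [set a | 0 <= a /\ [set a *: y | y in D] x] set0.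
  by rewrite inf0.
by apply: lb_le_inf => // a [].
Qed.

Lemma symmetric_convex_nbhs0 D : centrally_symmetric D -> convex_set D ->
  D° !=set0 -> exists2 e, 0 < e & ball (0 : 'rV[R]_n) e `<=` D.
Proof.
move=> sD cD [c /nbhs_ballP[e /= e0 eD]]; exists e => // x x0e.
have xe : `|x| < e by move: x0e; rewrite -ball_normE/= sub0r normrN.
have D1 : D (c + x).
  by apply: eD; rewrite -ball_normE/= opprD addrA subrr sub0r normrN.
have D2 : D (x - c).
  rewrite -sD; exists (c - x); last by rewrite opprB.
  by apply: eD; rewrite -ball_normE/= opprB addrC subrK.
have := convex_setE cD D1 D2 (_ : 0 <= 2^-1) (_ : 2^-1 <= 1).
have -> : 2^-1 *: (c + x) + (1 - 2^-1) *: (x - c) = x.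
  by apply/rowP => i; rewrite !mxE; field.
by apply; lra.
Qed.

(* When no multiple of [D] contains [x], [gauge D x] is the infimum of the
   empty set, namely [0]: a nonempty interior is needed. *)
Lemma gauge_ge1 D x : centrally_symmetric D -> convex_set D -> D° !=set0 ->
  ~ D x -> 1 <= gauge D x.
Proof.
move=> sD cD iD Dx; have [e e0 eD] := symmetric_convex_nbhs0 sD cD iD.
apply: lb_le_inf.
  pose a := (`|x| + 1) / e.
  have a0 : 0 < a by rewrite divr_gt0// ltr_wpDl.
  exists a; split; first exact: ltW.
  exists (a^-1 *: x); last by rewrite scalerA mulfV ?gt_eqF// scale1r.
  apply: eD; rewrite -ball_normE/= sub0r normrN normrZ gtr0_norm ?invr_gt0//.
  by rewrite invf_div -mulrAC ltr_pdivrMr ?ltr_wpDl// ltr_pM2l// ltrDl.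
move=> a [a0 [y Dy yx]]; rewrite leNgt; apply/negP => a1; apply: Dx.
have D0 : D 0 by apply: eD; exact: ballxx.
have := convex_setE cD Dy D0 a0 (ltW a1).
by rewrite scaler0 addr0 yx.
Qed.

End convex_set_rV.

Section Lp_ball_volume.
Context {R : realType} {n : nat}.
Implicit Types (D : set 'rV[R]_n) (w : 'rV[R]_n -> R) (p : R).

Let mS : measurable_fun [set: 'rV[R]_n] (\1_unit_sphere : 'rV[R]_n -> R).
Proof. by apply: measurable_indic; exact: measurable_unit_sphere. Qed.

Let sphere_integralE p (nu : {measure set 'rV[R]_n -> \bar R}) x :
  (\int[nu]_(t in unit_sphere) (`|dotp x t| `^ p)%:E =
   \int[nu]_t (\1_unit_sphere t * `|dotp x t| `^ p)%:E)%E.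
Proof.
rewrite [LHS]integral_mkcond; apply: eq_integral => t _.
by rewrite patchE indicE/=; case: ifPn => _; rewrite ?mul1r ?mul0r.
Qed.

Let measurable_sphere_kernel p :
  measurable_fun [set: 'rV[R]_n * 'rV[R]_n]
    (fun z => \1_unit_sphere z.2 * `|dotp z.1 z.2| `^ p : R).
Proof.
apply: measurable_funM; first exact: (measurableT_comp mS measurable_snd).
exact: measurable_norm_dotp_powR.
Qed.

Lemma measurable_sphere_moment p
    (nu : {sigma_finite_measure set 'rV[R]_n -> \bar R}) :
  measurable_fun [set: 'rV[R]_n]
    (fun x => \int[nu]_(t in unit_sphere) (`|dotp x t| `^ p)%:E)%E.
Proof.
under eq_fun do rewrite sphere_integralE.
apply: (measurable_fun_fubini_tonelli_F (fun z : 'rV[R]_n * 'rV[R]_n =>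
  (\1_unit_sphere z.2 * `|dotp z.1 z.2| `^ p)%:E)).
- by apply/measurable_EFinP; exact: measurable_sphere_kernel.
- by move=> z; rewrite lee_fin mulr_ge0 ?powR_ge0.
Qed.

Lemma weighted_moment_fubini p w
    (mu nu : {sigma_finite_measure set 'rV[R]_n -> \bar R}) :
  measurable_fun [set: 'rV[R]_n] w -> (forall x, 0 <= w x) ->
  (\int[mu]_x ((w x)%:E * \int[nu]_(t in unit_sphere) (`|dotp x t| `^ p)%:E) =
   \int[nu]_(t in unit_sphere) \int[mu]_x (w x * `|dotp x t| `^ p)%:E)%E.
Proof.
move=> mw w0.
pose f (z : 'rV[R]_n * 'rV[R]_n) : \bar R :=
  (w z.1 * (\1_unit_sphere z.2 * `|dotp z.1 z.2| `^ p))%:E.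
have mf : measurable_fun setT f.
  apply/measurable_EFinP; apply: measurable_funM => //.
  exact: (measurableT_comp mw measurable_fst).
have f0 z : (0 <= f z)%E by rewrite lee_fin !mulr_ge0 ?powR_ge0.
transitivity (\int[mu]_x \int[nu]_t f (x, t))%E.
  apply: eq_integral => x _; rewrite sphere_integralE -ge0_integralZl_EFin//.
  apply/measurable_EFinP; apply: measurable_funM => //.
  by apply: measurable_norm_dotp_powR => //; exact: measurable_cst.
rewrite (fubini_tonelli f mf f0) [RHS]integral_mkcond; apply: eq_integral => t _.
rewrite patchE /f/= indicE; case: ifPn => _; last first.
  by under eq_integral do rewrite mul0r mulr0; exact: integral0.
by under eq_integral do rewrite mul1r.
Qed.

Lemma Lp_ball_mass_ge D p (nu : {finite_measure set 'rV[R]_n -> \bar R}) :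
  (0 < n)%N -> 1 <= p -> convex_body D -> centrally_symmetric D ->
  (forall x, (gauge D x `^ p)%:E =
     \int[nu]_(t in unit_sphere) (`|dotp x t| `^ p)%:E)%E ->
  (1 <= ((4 * expR 2 * Num.sqrt p *
     fine (lebesgue_rV n D) `^ n%:R^-1) `^ p)%:E * nu unit_sphere)%E.
Proof.
move=> n0 p1 [cD xD iD] sD gD.
have p0 : 0 < p by exact: lt_le_trans p1.
have mD := compact_measurable_rV cD.
have n0' : n%:R != 0 :> R by rewrite pnatr_eq0 -lt0n.
set V := fine (lebesgue_rV n D).
have VD : lebesgue_rV n D = V%:E.
  by rewrite fineK// ge0_fin_numE// compact_volume_fin.
have V0 : 0 < V by rewrite -lte_fin -VD interior_volume_gt0.
set u := V `^ n%:R^-1.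
have u0 : 0 < u by exact: powR_gt0.
pose r := (2 * V) `^ n%:R^-1 / 2.
have r0 : 0 < r by rewrite divr_gt0// powR_gt0// mulr_gt0.
have rn : (2 * r) ^+ n = 2 * V.
  rewrite -powR_mulrn; last by apply: mulr_ge0 => //; exact: ltW.
  have -> : 2 * r = (2 * V) `^ n%:R^-1 by rewrite /r; field.
  by rewrite -powRrM mulVf// powRr1// mulr_ge0// ltW.
have ru : r <= u.
  rewrite /r powRM ?(ltW V0)// -/u ler_pdivrMr// mulrC ler_wpM2l ?(ltW u0)//.
  by apply: ler1_powR; rewrite ?ler1n// invf_le1 ?ltr0n// ler1n.
set Q := cube n r.
have mQ : measurable Q by exact: measurable_cube.
have hQ : (V%:E <= lebesgue_rV n (Q `\` D))%E.
  have QE : (lebesgue_rV n Q =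
      lebesgue_rV n (Q `\` D) + lebesgue_rV n (Q `&` D))%E.
    exact: measureDI.
  move: QE; rewrite {1}/Q (lebesgue_cube _ r0) rn => QE.
  rewrite -(@leeD2rE _ V%:E)// -EFinD.
  have -> : V + V = 2 * V by ring.
  rewrite QE leeD2l// -VD; apply: le_measure; rewrite ?inE//.
  exact: measurableI.
pose M := 2 * (r * Num.sqrt p) `^ p * expR (2 * p).
have M0 : 0 <= M by rewrite !mulr_ge0 ?expR_ge0 ?powR_ge0.
have hM : (V%:E <= (2 * V * M)%:E * nu unit_sphere)%E.
  apply: le_trans hQ _.
  rewrite -[Q `\` D]setIT -(integral_indic (lebesgue_rV n) measurableT); last first.
    exact: measurableD.
  apply: (@le_trans _ _ (\int[lebesgue_rV n]_x ((\1_Q x)%:E *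
      \int[nu]_(t in unit_sphere) (`|dotp x t| `^ p)%:E))%E).
    apply: ge0_le_integral => //.
    - by apply/measurable_EFinP; apply: measurable_indic; exact: measurableD.
    - apply: emeasurable_funM; last exact: measurable_sphere_moment.
      by apply/measurable_EFinP; exact: measurable_indic.
    - move=> x _; rewrite -gD -EFinM lee_fin.
      rewrite indicE; have [/set_mem[Qx Dx]|_] := boolP (x \in Q `\` D).
        rewrite indicE mem_set// mul1r.
        apply: (@le_trans _ _ (1 `^ p)); first by rewrite powR1.
        rewrite ge0_ler_powR ?nnegrE ?(ltW p0)//.
        + exact: gauge_ge0.
        + exact: gauge_ge1.
      by rewrite mulr_ge0 ?powR_ge0.
  rewrite weighted_moment_fubini//.
  apply: (@le_trans _ _ (\int[nu]_(t in unit_sphere) (2 * V * M)%:E)%E).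
    apply: ge0_le_integral => //.
    - exact: measurable_unit_sphere.
    - by move=> t _; apply: integral_ge0 => x _; rewrite lee_fin mulr_ge0 ?powR_ge0.
    - apply: measurable_funTS.
      apply: (measurable_fun_fubini_tonelli_G (fun z : 'rV[R]_n * 'rV[R]_n =>
        (\1_Q z.1 * `|dotp z.1 z.2| `^ p)%:E)).
        apply/measurable_EFinP; apply: measurable_funM.
          apply: (measurableT_comp _ measurable_fst).
          exact: measurable_indic.
        exact: measurable_norm_dotp_powR.
      by move=> z; rewrite lee_fin mulr_ge0 ?powR_ge0.
    - move=> t /unit_sphere_dotp t1.
      by rewrite -rn; exact: integral_cube_moment.
  by rewrite integral_cst//; exact: measurable_unit_sphere.
rewrite -(@lee_pmul2l _ V%:E)// mule1; apply: le_trans hM _.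
rewrite muleA -EFinM lee_wpmul2r// lee_fin.
have -> : 2 * V * M = V * (2 * M) by ring.
rewrite ler_wpM2l ?(ltW V0)//.
have q0 : 0 <= Num.sqrt p by exact: sqrtr_ge0.
rewrite -mulrA powRM ?mulr_ge0 ?expR_ge0// ?(ltW u0)//.
rewrite powRM ?expR_ge0// -expRM.
have -> : 2 * M = 4 * expR (2 * p) * (r * Num.sqrt p) `^ p by rewrite /M; ring.
apply: ler_pM; rewrite ?mulr_ge0 ?expR_ge0 ?powR_ge0//.
- by rewrite ler_wpM2r ?expR_ge0//; apply: le1r_powR => //; rewrite ler1n.
- rewrite ge0_ler_powR ?nnegrE//; [exact: ltW| | |].
  + by apply: mulr_ge0 => //; exact: ltW.
  + by apply: mulr_ge0 => //; exact: ltW.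
  + by rewrite mulrC ler_wpM2l.
Qed.

End Lp_ball_volume.

Section moments.
Context {R : realType} {n : nat}.
Implicit Types (D K : set 'rV[R]_n) (w : 'rV[R]_n -> R) (p r : R) (v : 'rV[R]_n).

Lemma Lp_ball_moment_le D p (mu : {sigma_finite_measure set 'rV[R]_n -> \bar R})
    w (m : \bar R) : (0 < n)%N -> 1 <= p -> Lp_ball p D ->
  measurable_fun [set: 'rV[R]_n] w -> (forall x, 0 <= w x) ->
  (forall x, w x != 0 -> D x) -> (0 <= m)%E ->
  (forall v, unit_sphere v ->
    m <= \int[mu]_x (w x * `|dotp x v| `^ p)%:E)%E ->
  (m <= ((4 * expR 2 * Num.sqrt p *
      fine (lebesgue_rV n D) `^ n%:R^-1) `^ p)%:E * \int[mu]_x (w x)%:E)%E.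
Proof.
move=> n0 p1 [bD sD [nu gD]] mw w0 wD m0 mle.
have p0 : 0 < p by exact: lt_le_trans p1.
have := Lp_ball_mass_ge n0 p1 bD sD gD.
set c := (_ `^ p) => nuS.
rewrite -[leLHS]mule1; apply: le_trans (lee_wpmul2l m0 nuS) _.
rewrite muleCA lee_wpmul2l ?lee_fin ?powR_ge0//.
rewrite -(integral_cst nu measurable_unit_sphere).
apply: (@le_trans _ _ (\int[nu]_(t in unit_sphere)
    \int[mu]_x (w x * `|dotp x t| `^ p)%:E)%E).
  apply: ge0_le_integral => //.
  - exact: measurable_unit_sphere.
  - apply: measurable_funTS.
    apply: (measurable_fun_fubini_tonelli_G (fun z : 'rV[R]_n * 'rV[R]_n =>
      (w z.1 * `|dotp z.1 z.2| `^ p)%:E)).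
      apply/measurable_EFinP; apply: measurable_funM.
        exact: (measurableT_comp mw measurable_fst).
      exact: measurable_norm_dotp_powR.
    by move=> z; rewrite lee_fin mulr_ge0 ?powR_ge0.
rewrite -weighted_moment_fubini//; apply: ge0_le_integral => //.
- by move=> x _; rewrite -gD -EFinM lee_fin mulr_ge0 ?powR_ge0.
- by apply: emeasurable_funM; [exact/measurable_EFinP|
                               exact: measurable_sphere_moment].
- exact/measurable_EFinP.
- move=> x _; rewrite -gD -EFinM lee_fin.
  have [->|/wD Dx] := eqVneq (w x) 0; first by rewrite mul0r.
  rewrite ler_piMr//; apply: (@le_trans _ _ (1 `^ p)); last by rewrite powR1.
  rewrite ge0_ler_powR ?nnegrE ?(ltW p0)//; first exact: gauge_ge0.
  exact: gauge_le1.
Qed.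

Lemma powR_le_lipschitz p (M s t : R) : 1 <= p ->
  0 <= s <= M -> 0 <= t <= M -> t `^ p <= s `^ p + (M + 1) `^ p * `|t - s|.
Proof.
move=> p1 /andP[s0 sM] /andP[t0 tM].
have p0 : 0 <= p by exact: le_trans p1.
have [ts|st] := leP t s.
  by rewrite ler_wpDr ?mulr_ge0 ?powR_ge0// ge0_ler_powR ?nnegrE.
have d0 : 0 < M + 1 - s by lra.
pose l := (t - s) / (M + 1 - s).
have l0 : 0 <= l by apply: divr_ge0; lra.
have l1 : l <= 1 by rewrite ler_pdivrMr//; lra.
have lts : l <= t - s by rewrite ler_pdivrMr// ler_peMr; lra.
have E : l * (M + 1) + (1 - l) * s = t.
  by rewrite /l; field; rewrite gt_eqF.
have : (l * (M + 1) + (1 - l) * s) `^ p <= l * (M + 1) `^ p + (1 - l) * s `^ p.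
  apply: (convex_powR p1 (Itv01 l0 l1)); rewrite inE/= in_itv/= andbT//; lra.
rewrite E => /le_trans; apply.
rewrite ger0_norm ?subr_ge0 ?(ltW st)//.
have := powR_ge0 (M + 1) p; have := powR_ge0 s p.
by nra.
Qed.

Lemma norm_dotp_cube_le r x v : 0 < r -> cube n r x ->
  `|dotp x v| <= n%:R * r * `|v|.
Proof.
move=> r0 xr; apply: le_trans (ler_norm_sum _ _ _) _.
apply: (@le_trans _ _ (\sum_(i < n) r * `|v|)).
  apply: ler_sum => i _; rewrite normrM ler_pM//; last exact: ler_norm_coord.
  by have := xr i; rewrite /= in_itv/= -ler_norml.
by rewrite sumr_const card_ord -[leLHS]mulr_natl mulrA.
Qed.

Lemma continuous_dotp_diag : continuous (fun v : 'rV[R]_n => dotp v v).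
Proof.
rewrite /dotp; elim: (index_enum _) => [|i s IH].
  rewrite (_ : (fun _ => _) = cst 0); first exact: cst_continuous.
  by apply/funext => v; rewrite big_nil.
rewrite (_ : (fun _ => _) =
  (fun v : 'rV[R]_n => v 0 i * v 0 i + \sum_(j <- s) v 0 j * v 0 j)).
  have ci : continuous (fun v : 'rV[R]_n => v 0 i).
    by move=> v; exact: coord_continuous.
  by move=> v; exact: (cvgD (cvgM (ci v) (ci v)) (IH v)).
by apply/funext => v; rewrite big_cons.
Qed.

Lemma unit_sphere_compact : compact (@unit_sphere R n).
Proof.
apply: bounded_closed_compact.
  exists 1; split => // M M1 v /unit_sphere_dotp v1 /=.
  apply: le_trans (ltW M1).
  rewrite [leLHS]/Num.norm/= mx_normrE; apply/bigmax_leP; split => // -[i j] _/=.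
  rewrite ord1 -(@expr_le1 _ 2)// real_normK ?num_real// -v1 /dotp (bigD1 j)//=.
  by rewrite expr2 lerDl sumr_ge0// => k _; rewrite -expr2 sqr_ge0.
rewrite (_ : unit_sphere = (fun v : 'rV[R]_n => dotp v v) @^-1` [set 1]).
  apply: closed_comp; last exact: closed_eq.
  by move=> v _; exact: continuous_dotp_diag.
by apply/seteqP; split => v /unit_sphere_dotp.
Qed.

Lemma unit_sphere_nonempty : (0 < n)%N -> @unit_sphere R n !=set0.
Proof.
move=> n0; exists (delta_mx 0 (Ordinal n0)); apply/unit_sphere_dotp.
rewrite /dotp (bigD1 (Ordinal n0))//= big1 => [|i /negPf i0].
  by rewrite !mxE !eqxx mulr1 addr0.
by rewrite !mxE i0 andbF mulr0.
Qed.

Lemma moment_argmin p r (mu : {measure set 'rV[R]_n -> \bar R}) w :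
  (0 < n)%N -> 1 <= p -> 0 < r ->
  measurable_fun [set: 'rV[R]_n] w -> (forall x, 0 <= w x) ->
  (forall x, w x != 0 -> cube n r x) -> (\int[mu]_x (w x)%:E < +oo)%E ->
  exists2 xi, unit_sphere xi & forall eta, unit_sphere eta ->
    (\int[mu]_x (w x * `|dotp x xi| `^ p)%:E <=
     \int[mu]_x (w x * `|dotp x eta| `^ p)%:E)%E.
Proof.
move=> n0 p1 r0 mw w0 wr wfin.
have p0 : 0 < p by exact: lt_le_trans p1.
set W := (\int[mu]_x (w x)%:E)%E in wfin.
have WE : W = (fine W)%:E.
  by rewrite fineK// ge0_fin_numE//; apply: integral_ge0 => x _; rewrite lee_fin.
have W0 : 0 <= fine W.
  by apply: fine_ge0; apply: integral_ge0 => x _; rewrite lee_fin.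
pose F v := (\int[mu]_x (w x * `|dotp x v| `^ p)%:E)%E.
have F0 v : (0 <= F v)%E.
  by apply: integral_ge0 => x _; rewrite lee_fin mulr_ge0 ?powR_ge0.
pose a := n%:R * r.
have a0 : 0 <= a by rewrite mulr_ge0// ltW.
pose L B := (a * B + 1) `^ p * a.
have L0 B : 0 <= L B by rewrite mulr_ge0 ?powR_ge0.
have FL B u v : `|u| <= B -> `|v| <= B ->
    (F v <= F u + (L B * `|v - u| * fine W)%:E)%E.
  move=> uB vB; rewrite EFinM -WE.
  have Lv0 : 0 <= L B * `|v - u| by rewrite mulr_ge0.
  have mF y : measurable_fun setT (fun x => (w x * `|dotp x y| `^ p)%:E).
    apply/measurable_EFinP; apply: measurable_funM => //.
    by apply: measurable_norm_dotp_powR => //; exact: measurable_cst.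
  have mwE : measurable_fun setT (fun x => (w x)%:E) by exact/measurable_EFinP.
  rewrite /F /W -ge0_integralZl_EFin//; last by move=> x _; rewrite lee_fin.
  rewrite -ge0_integralD//; last 3 first.
  - by move=> x _; rewrite lee_fin mulr_ge0 ?powR_ge0.
  - by move=> x _; rewrite -EFinM lee_fin mulr_ge0.
  - exact: emeasurable_funM.
  apply: ge0_le_integral => //.
  - by move=> x _; rewrite lee_fin mulr_ge0 ?powR_ge0.
  - by apply: emeasurable_funD => //; exact: emeasurable_funM.
  move=> x _; rewrite -EFinM -EFinD lee_fin [_ * w x]mulrC -mulrDr.
  have [->|/wr xr] := eqVneq (w x) 0; first by rewrite !mul0r.
  have xle y : `|y| <= B -> 0 <= `|dotp x y| <= a * B.
    move=> yB; rewrite normr_ge0/=.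
    by apply: le_trans (norm_dotp_cube_le y r0 xr) _; rewrite ler_wpM2l.
  rewrite ler_wpM2l//.
  apply: le_trans (powR_le_lipschitz p1 (xle _ uB) (xle _ vB)) _.
  rewrite lerD2l /L -mulrA ler_wpM2l ?powR_ge0//.
  apply: le_trans (ler_dist_dist _ _) _.
  by rewrite -dotpBr norm_dotp_cube_le.
have Ffin v : F v = (fine (F v))%:E.
  rewrite fineK// ge0_fin_numE//.
  have F00 : F 0 = 0%E.
    rewrite /F -(integral0 mu setT); apply: eq_integral => x _.
    rewrite (_ : dotp x 0 = 0) ?normr0 ?powR0 ?gt_eqF ?mulr0//.
    by rewrite /dotp big1// => i _; rewrite mxE mulr0.
  apply: (@le_lt_trans _ _ (F 0%R + (L `|v| * `|v - 0| * fine W)%:E)%E).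
    by apply: FL; rewrite ?normr0.
  by rewrite F00 add0e ltry.
have FE v : (\int[mu]_x (w x * `|dotp x v| `^ p)%:E)%E = F v by [].
clearbody F W L.
have FR B u v : `|u| <= B -> `|v| <= B ->
    fine (F v) <= fine (F u) + L B * `|v - u| * fine W.
  by move=> uB vB; rewrite -lee_fin EFinD -!Ffin; exact: FL.
have Fdist B u v : `|u| <= B -> `|v| <= B ->
    `|fine (F v) - fine (F u)| <= L B * fine W * `|v - u|.
  move=> uB vB; have := FR _ _ _ uB vB; have := FR _ _ _ vB uB.
  by rewrite distrC mulrAC ler_norml => h1 h2; apply/andP; split; lra.
have cF : continuous (fun v => fine (F v)).
  move=> v A /= /(nbhs_ballP (fine (F v)))[e /= e0 eA].
  pose k := L (`|v| + 1) * fine W + 1.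
  have k0 : 0 < k by rewrite ltr_wpDl// mulr_ge0.
  have d0 : 0 < Num.min 1 (e / k) by rewrite lt_min ltr01 divr_gt0.
  apply/nbhs_ballP; exists (Num.min 1 (e / k)) => // u.
  rewrite -ball_normE/= lt_min => /andP[vu1 vue].
  apply: eA; rewrite -ball_normE/=.
  have uB : `|u| <= `|v| + 1.
    rewrite -[u](subrK v) addrC; apply: le_trans (ler_normD _ _) _.
    by rewrite lerD2l distrC ltW.
  apply: le_lt_trans (Fdist (`|v| + 1) _ _ uB _) _; first by rewrite lerDl.
  rewrite ltr_pdivlMr// in vue.
  by apply: le_lt_trans vue; rewrite mulrC ler_wpM2l// /k lerDl ler01.
have [xi /set_mem xiS ximin] := EVT_min_rV (unit_sphere_nonempty n0)
  unit_sphere_compact (continuous_subspaceT cF).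
exists xi => [|eta /mem_set/ximin]; first exact: xiS.
by rewrite (FE xi) (FE eta) (Ffin xi) (Ffin eta) lee_fin; exact.
Qed.

Lemma measure_supportC_negligible (mu : {measure set 'rV[R]_n -> \bar R}) :
  mu.-negligible (~` measure_support mu).
Proof.
(* The complement of the support is covered by the null rational boxes. *)
pose box (f : {ffun 'I_n -> rat * rat}) :=
  [set x : 'rV[R]_n | forall i, ratr (f i).1 < x 0 i < ratr (f i).2].
pose N k := if unpickle k is Some f then
  (if mu (box f) == 0%E then box f else set0) else set0.
have mbox f : measurable (box f).
  rewrite (_ : box f = \bigcap_(i in [set: 'I_n]) ((fun x : 'rV[R]_n => x 0 i)
      @^-1` `]ratr (f i).1, ratr (f i).2[%classic)).
    apply: fin_bigcap_measurable => // i _.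
    by rewrite -[X in measurable X]setTI; apply: measurable_coord.
  apply/seteqP; split => [x xf i _|x xf i]; first by rewrite /= in_itv/=.
  by have := xf i Logic.I; rewrite /= in_itv.
apply: (@negligibleS _ _ _ _ (\bigcup_k N k)); last first.
  apply: negligible_bigcup => k; rewrite /N.
  case: unpickle => [f|]; last exact: negligible_set0.
  case: eqP => [muf|_]; last exact: negligible_set0.
  by exists (box f); split.
move=> x /existsNP[U /not_implyP[[oU Ux] /negP U0]].
have muU : mu U = 0%E.
  by apply/eqP; rewrite eq_le measure_ge0 andbT leNgt.
move: Ux; rewrite (open_rV_bigcup oU) => -[f _ [xf fU]].
exists (pickle f) => //; rewrite /N pickleK ifT//.
rewrite eq_le measure_ge0 andbT -muU; apply: le_measure => //.
- by rewrite inE; exact: mbox.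
- by rewrite inE; exact: sub_sigma_algebra.
Qed.

End moments.

Section weights.
Context {R : realType} {n : nat}.
Implicit Types (K : set 'rV[R]_n) (f w : 'rV[R]_n -> R) (p : R).

Lemma continuous_within_measurable K f : closed K ->
  {within K, continuous f} -> measurable_fun K f.
Proof.
move=> cK cf; apply: (measurability _ (RGenOInfty.measurableE R)).
move=> _ [_ [a ->] <-].
move/continuousP : cf => /(_ _ (@interval_open _ _ _ _ _)).
move=> /(_ (BRight a) +oo%O) /(_ isT isT) /open_subspaceP[V oV VK].
rewrite setIC -VK; apply: measurableI; first exact: sub_sigma_algebra.
exact: closed_measurable_rV.
Qed.

Lemma compact_integral_fin K f : compact K -> {within K, continuous f} ->
  (forall x, K x -> 0 <= f x) -> (\int[lebesgue_rV n]_(x in K) (f x)%:E < +oo)%E.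
Proof.
move=> cK cf f0.
have [M [_ fM]] := compact_bounded (continuous_compact cf cK).
have mK := compact_measurable_rV cK.
apply: (@le_lt_trans _ _ (\int[lebesgue_rV n]_(x in K) (`|M| + 1)%:E)%E).
  apply: ge0_le_integral => //.
  - apply/measurable_EFinP.
    exact: (continuous_within_measurable (compact_closed_rV cK) cf).
  - move=> x Kx; rewrite lee_fin; apply: le_trans (ler_norm _) _.
    apply: (fM (`|M| + 1)); last by exists x.
    by rewrite (le_lt_trans (ler_norm M))// ltrDl.
rewrite integral_cst// lte_mul_pinfty ?lee_fin ?addr_ge0//.
exact: compact_volume_fin.
Qed.

Lemma integral_measure_support (mu : {measure set 'rV[R]_n -> \bar R}) K
    (g : 'rV[R]_n -> R) : measurable K -> measure_support mu = K ->
  measurable_fun [set: 'rV[R]_n] g -> (forall x, 0 <= g x) ->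
  (\int[mu]_x (g x)%:E = \int[mu]_x (\1_K x * g x)%:E)%E.
Proof.
move=> mK supK mg g0; apply: ge0_ae_eq_integral => //.
- exact/measurable_EFinP.
- by apply/measurable_EFinP; apply: measurable_funM => //; exact: measurable_indic.
- by move=> x _; rewrite lee_fin.
- by move=> x _; rewrite lee_fin mulr_ge0.
- apply: negligibleS (measure_supportC_negligible mu) => x /= gx; rewrite supK => Kx.
  by apply: gx => _; rewrite indicE mem_set// mul1r.
Qed.

Lemma weighted_moment_le p r (mu : {measure set 'rV[R]_n -> \bar R}) w v :
  0 <= p -> 0 < r -> measurable_fun [set: 'rV[R]_n] w -> (forall x, 0 <= w x) ->
  (forall x, w x != 0 -> cube n r x) ->
  (\int[mu]_x (w x * `|dotp x v| `^ p)%:E <=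
   ((n%:R * r * `|v|) `^ p)%:E * \int[mu]_x (w x)%:E)%E.
Proof.
move=> p0 r0 mw w0 wr.
have mwE : measurable_fun setT (fun x => (w x)%:E) by exact/measurable_EFinP.
rewrite -ge0_integralZl_EFin ?powR_ge0//; last by move=> x _; rewrite lee_fin.
apply: ge0_le_integral => //.
- by move=> x _; rewrite lee_fin mulr_ge0 ?powR_ge0.
- apply/measurable_EFinP; apply: measurable_funM => //.
  by apply: measurable_norm_dotp_powR => //; exact: measurable_cst.
- exact: emeasurable_funM.
- move=> x _; rewrite -EFinM lee_fin mulrC.
  have [->|/wr xr] := eqVneq (w x) 0; first by rewrite !mulr0.
  rewrite ler_wpM2r// ge0_ler_powR ?nnegrE ?mulr_ge0 ?(ltW r0)//.
  exact: norm_dotp_cube_le.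
Qed.

Lemma volume_ratio_ge (c k G I V : R) p (q : R) :
  0 < c -> 0 < k -> 0 < I -> 0 < p -> 0 <= G -> 0 <= V ->
  G <= (c * V `^ q) `^ p * I ->
  (G / (c `^ p * k `^ (p * q) * I)) `^ p^-1 <= (V / k) `^ q.
Proof.
move=> c0 k0 I0 p0 G0 V0 GV.
have A0 : 0 < c `^ p * k `^ (p * q) * I by rewrite !mulr_gt0 ?powR_gt0.
have y0 : 0 <= (V / k) `^ q by exact: powR_ge0.
have -> : (V / k) `^ q = ((V / k) `^ q `^ p) `^ p^-1.
  by rewrite -[RHS]powRrM mulfV ?gt_eqF// powRr1.
rewrite ge0_ler_powR ?nnegrE ?invr_ge0 ?powR_ge0 ?(ltW p0)//.
  by rewrite divr_ge0// ltW.
rewrite ler_pdivrMr//; apply: le_trans GV _.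
have {1}-> : V = (V / k) * k by rewrite divfK ?gt_eqF.
rewrite [(V / k * k) `^ q]powRM ?divr_ge0 ?(ltW k0)//.
rewrite powRM ?mulr_ge0 ?powR_ge0 ?(ltW c0)// powRM ?powR_ge0//.
rewrite [p * q]mulrC [k `^ (q * p)]powRrM.
by move: (_ `^ p) (_ `^ p) (_ `^ p) => x y z; nra.
Qed.

End weights.

Section outer_volume_ratio.
Context {R : realType} {n : nat}.
Implicit Types (D K : set 'rV[R]_n) (p : R).

Lemma moment_root_le_volume_radius p (c : R) K (G : \bar R) : 1 <= p -> 0 < c ->
  (0 <= G)%E ->
  (forall D, K `<=` D -> Lp_ball p D ->
    G <= ((c * fine (lebesgue_rV n D) `^ n%:R^-1) `^ p)%:E)%E ->
  (G `^ p^-1 <= c%:E * volume_radius_Lp p K)%E.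
Proof.
move=> p1 c0 G0 GD; have p0 : 0 < p by exact: lt_le_trans p1.
rewrite -lee_pdivrMl//; apply/ereal_infP => _ [D [KD LD] <-].
rewrite lee_pdivrMl//.
have VD : lebesgue_rV n D = (fine (lebesgue_rV n D))%:E.
  by rewrite fineK// ge0_fin_numE// compact_volume_fin//; case: LD => -[].
rewrite VD poweR_EFin -EFinM.
apply: (@le_trans _ _
  (((c * fine (lebesgue_rV n D) `^ n%:R^-1) `^ p)%:E `^ p^-1)%E).
  apply: gt0_ler_poweR; rewrite ?invr_ge0 ?(ltW p0)//; last exact: GD.
    by rewrite in_itv/= G0 leey.
  by rewrite in_itv/= leey lee_fin powR_ge0.
rewrite poweR_EFin -powRrM mulfV ?gt_eqF// powRr1//.
by rewrite mulr_ge0 ?powR_ge0// ltW.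
Qed.

Lemma moment_le_d_ovr p (c G I : R) K : 1 <= p -> 0 < c ->
  compact K -> (0 < lebesgue_rV n K)%E -> 0 <= G -> 0 < I ->
  (forall D, K `<=` D -> Lp_ball p D ->
    G <= (c * fine (lebesgue_rV n D) `^ n%:R^-1) `^ p * I) ->
  (G%:E <= (c `^ p)%:E * d_ovr_Lp p K `^ p *
    lebesgue_rV n K `^ (p / n%:R) * I%:E)%E.
Proof.
move=> p1 c0 cK K0 G0 I0 GD; have p0 : 0 < p by exact: lt_le_trans p1.
have KE : lebesgue_rV n K = (fine (lebesgue_rV n K))%:E.
  by rewrite fineK// ge0_fin_numE// compact_volume_fin.
have k0 : 0 < fine (lebesgue_rV n K) by rewrite -lte_fin -KE.
set k := fine _ in KE k0.
have A0 : 0 < c `^ p * k `^ (p / n%:R) * I by rewrite !mulr_gt0 ?powR_gt0.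
set A := (_ * I) in A0.
have gd : (((G / A) `^ p^-1)%:E <= d_ovr_Lp p K)%E.
  apply/ereal_infP => _ [D [KD LD] <-].
  have VD : lebesgue_rV n D = (fine (lebesgue_rV n D))%:E.
    by rewrite fineK// ge0_fin_numE// compact_volume_fin//; case: LD => -[].
  rewrite KE VD inver gt_eqF// -EFinM poweR_EFin lee_fin.
  by apply: volume_ratio_ge => //; [exact: fine_ge0|exact: GD].
have GA0 : 0 <= G / A by rewrite divr_ge0// ltW.
have : ((G / A)%:E <= d_ovr_Lp p K `^ p)%E.
  apply: (@le_trans _ _ (((G / A) `^ p^-1)%:E `^ p)%E).
    by rewrite poweR_EFin -powRrM mulVf ?gt_eqF// powRr1.
  apply: gt0_ler_poweR => //; first exact: ltW.
    by rewrite in_itv/= leey lee_fin powR_ge0.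
  rewrite in_itv/= leey andbT; apply: le_trans gd.
  by rewrite lee_fin powR_ge0.
rewrite KE poweR_EFin => dG.
rewrite [(_ * d_ovr_Lp p K `^ p)%E]muleC -!muleA -!EFinM.
have -> : G%:E = ((G / A)%:E * A%:E)%E by rewrite -EFinM divfK ?gt_eqF.
rewrite mulrA -/A; apply: lee_wpmul2r dG.
by rewrite lee_fin ltW.
Qed.

End outer_volume_ratio.

Theorem theorem1p2 (R : realType) :
  (exists C : R, 0 < C /\
    forall (n : nat) (p : R), (0 < n)%N -> 1 <= p ->
    forall (mu : probability 'rV[R]_n R) (K : set 'rV[R]_n),
      measure_support mu = K -> compact K ->
      exists xi : 'rV[R]_n, [/\ unit_sphere xi,
        (forall eta : 'rV[R]_n, unit_sphere eta ->
          (\int[mu]_x (`|dotp x xi| `^ p)%:E) `^ p^-1 <=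
          (\int[mu]_x (`|dotp x eta| `^ p)%:E) `^ p^-1)%E &
        ((\int[mu]_x (`|dotp x xi| `^ p)%:E) `^ p^-1 <=
          (C * Num.sqrt p)%:E * volume_radius_Lp p K)%E])
  /\
  (exists C : R, 0 < C /\
    forall (n : nat) (p : R), (0 < n)%N -> 1 <= p ->
    forall (K : set 'rV[R]_n) (f : 'rV[R]_n -> R),
      compact K -> (0 < lebesgue_rV n K)%E ->
      {within K, continuous f} -> (forall x, K x -> 0 <= f x) ->
      exists xi : 'rV[R]_n, [/\ unit_sphere xi,
        (forall eta : 'rV[R]_n, unit_sphere eta ->
          \int[lebesgue_rV n]_(x in K) (`|dotp x xi| `^ p * f x)%:E <=
          \int[lebesgue_rV n]_(x in K) (`|dotp x eta| `^ p * f x)%:E)%E &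
        (\int[lebesgue_rV n]_(x in K) (`|dotp x xi| `^ p * f x)%:E <=
          ((C * p) `^ (p / 2))%:E * d_ovr_Lp p K `^ p *
          lebesgue_rV n K `^ (p / n%:R) *
          \int[lebesgue_rV n]_(x in K) (f x)%:E)%E]).
Proof.
pose c : R := 4 * expR 2.
have c0 : 0 < c by rewrite mulr_gt0 ?expR_gt0.
split.
  exists c; split=> // n p n0 p1 mu K supK cK.
  have p0 : 0 < p by exact: lt_le_trans p1.
  have q0 : 0 < Num.sqrt p by rewrite sqrtr_gt0.
  have mK := compact_measurable_rV cK.
  have [r r0 Kr] := compact_sub_cube cK.
  pose w : 'rV[R]_n -> R := \1_K.
  have mw : measurable_fun setT w by exact: measurable_indic.
  have w0 x : 0 <= w x by rewrite /w indicE.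
  have wK x : w x != 0 -> K x.
    by rewrite /w indicE; case: (boolP (x \in K)) => [/set_mem//|_ /eqP].
  have WE : (\int[mu]_x (w x)%:E <= 1)%E.
    by rewrite integral_indic// setIT probability_le1.
  have GE v : (\int[mu]_x (`|dotp x v| `^ p)%:E =
      \int[mu]_x (w x * `|dotp x v| `^ p)%:E)%E.
    apply: (integral_measure_support (g := fun x => `|dotp x v| `^ p)) => //.
    by apply: measurable_norm_dotp_powR => //; exact: measurable_cst.
  have [xi xiS ximin] := moment_argmin n0 p1 r0 mw w0
    (fun x wx => Kr x (wK x wx)) (le_lt_trans WE (ltry 1)).
  have G0 v : (0 <= \int[mu]_x (w x * `|dotp x v| `^ p)%:E)%E.
    by apply: integral_ge0 => x _; rewrite lee_fin mulr_ge0 ?powR_ge0.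
  exists xi; split; first exact: xiS.
    move=> eta etaS; rewrite !GE; apply: gt0_ler_poweR.
    - by rewrite invr_ge0 ltW.
    - by rewrite in_itv/= G0 leey.
    - by rewrite in_itv/= G0 leey.
    - exact: ximin.
  rewrite GE; apply: moment_root_le_volume_radius => //; first exact: mulr_gt0.
  move=> D KD LD.
  apply: le_trans (Lp_ball_moment_le n0 p1 LD mw w0 _ (G0 xi) ximin) _.
    by move=> x /wK/KD.
  by rewrite -[leRHS]mule1 lee_wpmul2l// lee_fin powR_ge0.
exists (c ^+ 2); split; first exact: exprn_gt0.
move=> n p n0 p1 K f cK K0 cf f0.
have p0 : 0 < p by exact: lt_le_trans p1.
have q0 : 0 < Num.sqrt p by rewrite sqrtr_gt0.
have mK := compact_measurable_rV cK.
have [r r0 Kr] := compact_sub_cube cK.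
pose w := f \_ K.
have mw : measurable_fun setT w.
  apply/(measurable_restrictT f mK).
  exact: (continuous_within_measurable (compact_closed_rV cK) cf).
have w0 x : 0 <= w x.
  by rewrite /w patchE; case: ifPn => // /set_mem; exact: f0.
have wK x : w x != 0 -> K x.
  by rewrite /w patchE; case: ifPn => [/set_mem//|_ /eqP].
have WE : (\int[lebesgue_rV n]_(x in K) (f x)%:E =
    \int[lebesgue_rV n]_x (w x)%:E)%E.
  rewrite [LHS]integral_mkcond; apply: eq_integral => x _.
  by rewrite /w !patchE; case: ifPn.
have GE v : (\int[lebesgue_rV n]_(x in K) (`|dotp x v| `^ p * f x)%:E =
    \int[lebesgue_rV n]_x (w x * `|dotp x v| `^ p)%:E)%E.
  rewrite [LHS]integral_mkcond; apply: eq_integral => x _.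
  by rewrite /w !patchE; case: ifPn => _; [rewrite mulrC|rewrite mul0r].
have Wfin := compact_integral_fin cK cf f0.
rewrite WE in Wfin.
have wr x : w x != 0 -> cube n r x by move=> /wK/Kr.
have [xi xiS ximin] := moment_argmin n0 p1 r0 mw w0 wr Wfin.
exists xi; split; first exact: xiS.
  by move=> eta etaS; rewrite !GE; exact: ximin.
rewrite GE WE.
have : (0 <= \int[lebesgue_rV n]_x (w x * `|dotp x xi| `^ p)%:E)%E.
  by apply: integral_ge0 => x _; rewrite lee_fin mulr_ge0 ?powR_ge0.
have := weighted_moment_le (lebesgue_rV n) xi (ltW p0) r0 mw w0 wr.
have GD D (KD : K `<=` D) (LD : Lp_ball p D) := fun G0 =>
  Lp_ball_moment_le n0 p1 LD mw w0 (fun x wx => KD x (wK x wx)) G0 ximin.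
have W0 : (0 <= \int[lebesgue_rV n]_x (w x)%:E)%E.
  by apply: integral_ge0 => x _; rewrite lee_fin.
move: GD W0 Wfin.
move: (\int[_]_x (w x * _)%:E)%E (\int[_]_x (w x)%:E)%E.
move=> G [I| |]// GD; rewrite lee_fin => I0 _ Gle G0.
move: G G0 GD Gle => [G| |]//; rewrite lee_fin => G0 GD.
rewrite -EFinM lee_fin => Gle.
have [I1|I1] := eqVneq I 0.
  by move: Gle; rewrite I1 mulr0 mule0 lee_fin.
have -> : (c ^+ 2 * p) `^ (p / 2) = (c * Num.sqrt p) `^ p.
  rewrite -[p in c ^+ 2 * p]sqr_sqrtr ?(ltW p0)// -exprMn -powR_mulrn.
    by rewrite -powRrM; congr (_ `^ _); field.
  by rewrite mulr_ge0 ?ltW.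
apply: moment_le_d_ovr => //; first exact: mulr_gt0.
  by rewrite lt_neqAle eq_sym I1.
move=> D KD LD; rewrite -lee_fin EFinM.
by apply: GD => //; rewrite lee_fin.
Qed.
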